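(* Let $X\in\mathbb{R}^{n\times p}$ be deterministic with $\|X_j\|_2^2=n$ for all $j\in[p]$, let $\beta^*\in\mathbb{R}^p$ have support $S$ with $|S|=s$, let $\sigma>0$, and let $y=X\beta^*+\varepsilon$ with $\varepsilon\sim\mathcal{N}(0,\sigma^2I_n)$. Assume that $X$ satisfies the restricted eigenvalue condition RE($3$, $s$), let $\lambda_1=2\sigma\sqrt{2\log(p/\delta)/n}$ for some $\delta\in(0,1)$, and let $\lambda_2>0$. Let $\hat\beta=\hat\beta^{\lambda_1}$ be a Lasso solution with parameter $\lambda_1$ and let $\bar\beta=\hat\beta^{\lambda_1,\lambda_2}$ be a Boosted Lasso refitting of $\hat\beta$. Then with probability at least $1-\delta$, $$\frac1n\|X(\beta^*-\bar\beta)\|_2^2+(2\lambda_2-\lambda_1)\|\bar\beta-\hat\beta\|_1\le\frac{9\lambda_1^2s}{4\kappa^2(3,s)} .$$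
   Context: $[p]=\{1,\dots,p\}$; $X_j$ is the $j$-th column of $X$; for $J\subset[p]$, $\Delta_J$ is the subvector of $\Delta$ indexed by $J$ and $J^c=[p]\setminus J$. A Lasso solution with parameter $\lambda_1>0$ is any $\hat\beta^{\lambda_1}\in\arg\min_{\beta\in\mathbb{R}^p}\frac{1}{2n}\|y-X\beta\|_2^2+\lambda_1\|\beta\|_1$. A Boosted Lasso refitting is any $\hat\beta^{\lambda_1,\lambda_2}\in\arg\min_{\beta\in\mathbb{R}^p}\frac1{2n}\|y-X\beta\|_2^2+\lambda_2\|\beta-\hat\beta^{\lambda_1}\|_1$. $X$ satisfies RE($c_0$, $s$), where $c_0>0$ and $s\in[p]$, if there is a constant $\kappa(c_0,s)>0$ such that for all $J\subset[p]$ with $|J|\le s$ and all $\Delta\in\mathbb{R}^p$ (nonzero on $J$), $\|\Delta_{J^c}\|_1\le c_0\|\Delta_J\|_1$ implies $\frac{\|X\Delta\|_2^2}{n\|\Delta_J\|_2^2}\ge\kappa^2(c_0,s)$. *)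

(* Defs.v *)
From HB Require Import structures.
From mathcomp Require Import all_boot all_order all_algebra.
From mathcomp Require Import all_classical all_reals all_analysis.
Import Order.TTheory GRing.Theory Num.Theory.
Import numFieldNormedType.Exports.

Set Implicit Arguments.
Unset Strict Implicit.
Unset Printing Implicit Defensive.

Local Open Scope classical_set_scope.
Local Open Scope ring_scope.

(* The library norm on matrices is the sup norm, so the l1 and l2 norms on R^m
   are introduced here. *)
Definition norm1 (R : realType) (m : nat) (v : 'cV[R]_m) : R :=
  \sum_(i < m) `|v i 0|.

Definition norm2 (R : realType) (m : nat) (v : 'cV[R]_m) : R :=
  Num.sqrt (\sum_(i < m) v i 0 ^+ 2).

Definition vsupport (R : realType) (m : nat) (v : 'cV[R]_m) : {set 'I_m} :=
  [set j | v j 0 != 0]%SET.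

Definition subvec (R : realType) (m : nat) (J : {set 'I_m}) (v : 'cV[R]_m) :
    'cV[R]_#|J| :=
  \col_(k < #|J|) v (enum_val k) 0.

Definition argmin (R : realType) (U : Type) (f : U -> R) : set U :=
  [set x | forall z, f x <= f z].

Definition lasso (R : realType) (n p : nat) (X : 'M[R]_(n, p)) (y : 'cV[R]_n)
    (lambda1 : R) : set 'cV[R]_p :=
  argmin (fun beta : 'cV[R]_p =>
    (2 * n%:R)^-1 * norm2 (y - X *m beta) ^+ 2 + lambda1 * norm1 beta).

Definition boosted_lasso (R : realType) (n p : nat) (X : 'M[R]_(n, p))
    (y : 'cV[R]_n) (lambda2 : R) (betahat : 'cV[R]_p) : set 'cV[R]_p :=
  argmin (fun beta : 'cV[R]_p =>
    (2 * n%:R)^-1 * norm2 (y - X *m beta) ^+ 2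
      + lambda2 * norm1 (beta - betahat)).

(* The condition RE(c0, s), witnessed by the constant kappa = kappa(c0, s). *)
Definition restricted_eigenvalue (R : realType) (n p : nat)
    (X : 'M[R]_(n, p)) (c0 : R) (s : nat) (kappa : R) : Prop :=
  [/\ 0 < c0, (1 <= s <= p)%N, 0 < kappa &
   forall (J : {set 'I_p}) (Delta : 'cV[R]_p),
     (#|J| <= s)%N -> subvec J Delta != 0 ->
     norm1 (subvec (~: J)%SET Delta) <= c0 * norm1 (subvec J Delta) ->
     kappa ^+ 2 <=
       norm2 (X *m Delta) ^+ 2 / (n%:R * norm2 (subvec J Delta) ^+ 2)].

Definition mutually_independent (R : realType) (d : measure_display)
    (T : measurableType d) (P : probability T R) (n : nat)
    (Z : 'I_n -> {RV P >-> R}) : Prop :=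
  forall (I : {set 'I_n}) (B : 'I_n -> set R),
    (forall i, i \in I -> measurable (B i)) ->
    P (\bigcap_(i in [set` I]) (Z i @^-1` B i)) =
    (\prod_(i in I) P (Z i @^-1` B i))%E.

(* N(0, sigma^2 I_n): independent coordinates, each of them N(0, sigma^2).
   The second parameter of normal_prob is the standard deviation. *)
Definition isotropic_gaussian (R : realType) (d : measure_display)
    (T : measurableType d) (P : probability T R) (n : nat)
    (Z : 'I_n -> {RV P >-> R}) (sigma : R) : Prop :=
  (forall (i : 'I_n) (B : set R), measurable B ->
     distribution P (Z i) B = normal_prob 0 sigma B) /\
  mutually_independent Z.

(* P(E) >= a.  The event E need not be measurable, since it may involve
   arbitrary selections of minimizers; the bound is on its inner probability. *)
Definition with_probability_at_least (R : realType) (d : measure_display)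
    (T : measurableType d) (P : probability T R) (a : R) (E : set T) : Prop :=
  exists A : set T, [/\ measurable A, A `<=` E & (a%:E <= P A)%E].

(* Main.v *)
(* Write [u = bbar - bhat]. Optimality of [bbar] tested against [bhat] gives
     |X(bstar - bbar)|^2 / n + 2 lambda2 |u|_1
       <= |X(bstar - bhat)|^2 / n + 2 <eps, X u> / n,
   so on the event |X^T eps|_oo <= n lambda1 / 2 the claim follows from the
   usual Lasso bound on |X(bstar - bhat)|^2 / n.

   The probability [1 - delta] with this [lambda1] needs the sharp tail bound
   P(|G| > t) <= exp(- t^2 / 2) for a standard Gaussian G, without the factor 2
   of the Chernoff bound. It is obtained from the Cameron-Martin identity
     E f(G - t v) = E [f(G) exp(- t G - t^2 v / 2)],  f >= 0,
   for centered Gaussian G of variance v: the identity holds for a normal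
   variable by translation invariance of Lebesgue measure, is stable under
   scaling and independent sums, and applied to the indicators of the two open
   half-lines bounds P(|G| > t v) by exp(- t^2 v / 2) P(G <> 0). *)
Require Import Defs.
From HB Require Import structures.
From mathcomp Require Import all_boot all_order all_algebra.
From mathcomp Require Import all_classical all_reals all_analysis.
From mathcomp Require Import measurable_realfun.
From mathcomp Require Import ring lra.
Import Order.TTheory GRing.Theory Num.Theory.
Import numFieldNormedType.Exports.

Set Implicit Arguments.
Unset Strict Implicit.
Unset Printing Implicit Defensive.

Local Open Scope classical_set_scope.
Local Open Scope ring_scope.

(** * Deterministic part: optimality conditions and prediction error bounds *)

Section deterministic.
Context {R : realType}.

Definition dotv m (u v : 'cV[R]_m) : R := \sum_(i < m) u i 0 * v i 0.

Lemma norm2_sqr m (v : 'cV[R]_m) : norm2 v ^+ 2 = dotv v v.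
Proof.
rewrite sqr_sqrtr; last by apply: sumr_ge0 => i _; rewrite sqr_ge0.
by apply: eq_bigr => i _; rewrite expr2.
Qed.

Lemma dotvC m (u v : 'cV[R]_m) : dotv u v = dotv v u.
Proof. by apply: eq_bigr => i _; rewrite mulrC. Qed.

Lemma dotvDl m (u v w : 'cV[R]_m) : dotv (u + v) w = dotv u w + dotv v w.
Proof. by rewrite -big_split; apply: eq_bigr => i _; rewrite mxE mulrDl. Qed.

Lemma dotvZl m (a : R) (u w : 'cV[R]_m) : dotv (a *: u) w = a * dotv u w.
Proof. by rewrite mulr_sumr; apply: eq_bigr => i _; rewrite mxE mulrA. Qed.

Lemma dotvDr m (u v w : 'cV[R]_m) : dotv w (u + v) = dotv w u + dotv w v.
Proof. by rewrite dotvC dotvDl !(dotvC w). Qed.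

Lemma dotvZr m (a : R) (u w : 'cV[R]_m) : dotv w (a *: u) = a * dotv w u.
Proof. by rewrite dotvC dotvZl dotvC. Qed.

Lemma dotvNl m (u w : 'cV[R]_m) : dotv (- u) w = - dotv u w.
Proof. by rewrite -scaleN1r dotvZl mulN1r. Qed.

Lemma dotvNr m (u w : 'cV[R]_m) : dotv w (- u) = - dotv w u.
Proof. by rewrite dotvC dotvNl dotvC. Qed.

Lemma dotv_ge0 m (v : 'cV[R]_m) : 0 <= dotv v v.
Proof. by rewrite -norm2_sqr sqr_ge0. Qed.

Lemma norm1_ge0 m (v : 'cV[R]_m) : 0 <= norm1 v.
Proof. by apply: sumr_ge0. Qed.

Lemma norm10 m : norm1 (0 : 'cV[R]_m) = 0.
Proof. by apply: big1 => i _; rewrite mxE normr0. Qed.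

Lemma norm1N m (v : 'cV[R]_m) : norm1 (- v) = norm1 v.
Proof. by apply: eq_bigr => i _; rewrite mxE normrN. Qed.

Lemma norm1Z m a (v : 'cV[R]_m) : norm1 (a *: v) = `|a| * norm1 v.
Proof. by rewrite mulr_sumr; apply: eq_bigr => i _; rewrite mxE normrM. Qed.

Lemma norm1D m (u v : 'cV[R]_m) : norm1 (u + v) <= norm1 u + norm1 v.
Proof. by rewrite -big_split; apply: ler_sum => i _; rewrite mxE ler_normD. Qed.

Lemma dotv_mulmx n p (X : 'M[R]_(n, p)) (u : 'cV[R]_n) (h : 'cV[R]_p) :
  dotv u (X *m h) = \sum_(j < p) dotv (col j X) u * h j 0.
Proof.
transitivity (\sum_(i < n) \sum_(j < p) u i 0 * (X i j * h j 0)).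
  by apply: eq_bigr => i _; rewrite mxE mulr_sumr.
rewrite exchange_big; apply: eq_bigr => j _.
by rewrite mulr_suml; apply: eq_bigr => i _; rewrite mxE; ring.
Qed.

(** Hölder's inequality between the sup norm of X^T u and the l1 norm of [h]; it converts noise into
    an l1 penalty. *)
Lemma dotv_mulmx_le n p (X : 'M[R]_(n, p)) (u : 'cV[R]_n) (h : 'cV[R]_p) (c : R) :
  (forall j, `|dotv (col j X) u| <= c) -> `|dotv u (X *m h)| <= c * norm1 h.
Proof.
move=> Xc; rewrite dotv_mulmx mulr_sumr (le_trans (ler_norm_sum _ _ _))//.
by apply: ler_sum => j _; rewrite normrM ler_wpM2r.
Qed.

Lemma dotv_subZ m (u v : 'cV[R]_m) (t : R) :
  dotv (u - t *: v) (u - t *: v) =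
  dotv u u - 2 * t * dotv u v + t ^+ 2 * dotv v v.
Proof. by rewrite -scaleNr dotvDl !dotvDr !dotvZl !dotvZr (dotvC v u); ring. Qed.

(** A negative slope [b] would dominate the quadratic term for small [t]. *)
Lemma linear_term_ge0 (a b : R) :
  (forall t, 0 < t <= 1 -> 0 <= t * b + t ^+ 2 * a) -> 0 <= b.
Proof.
move=> H; rewrite leNgt; apply/negP => b0.
have a0 : 0 <= a by have := H 1; rewrite ltr01 lexx /= => /(_ isT); lra.
(* This choice gives [t * a < - b / 2], hence [t * b + t ^+ 2 * a < t * b / 2 < 0]. *)
pose t := Num.min 1 (- b / (2 * (a + 1))).
have d0 : 0 < 2 * (a + 1) by lra.
have t0 : 0 < t by rewrite lt_min ltr01 divr_gt0// oppr_gt0.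
have := H t; rewrite t0 ge_min lexx /= => /(_ isT).
have ta : t * (2 * (a + 1)) <= - b by rewrite -ler_pdivlMr// ge_min lexx orbT.
nra.
Qed.

(* Divide the optimality inequality along [x + t (z - x)] by [t] and let [t]
   tend to 0. *)
Lemma penalized_argmin_optimality n p (X : 'M[R]_(n, p)) (y : 'cV[R]_n)
    (lambda : R) (c x z : 'cV[R]_p) : 0 <= lambda ->
  argmin (fun b => (2 * n%:R)^-1 * norm2 (y - X *m b) ^+ 2
    + lambda * norm1 (b - c)) x ->
  n%:R^-1 * dotv (y - X *m x) (X *m (z - x)) <=
    lambda * (norm1 (z - c) - norm1 (x - c)).
Proof.
move=> l0 xmin; set r := y - X *m x; set h := X *m (z - x).
rewrite -subr_ge0; apply: (@linear_term_ge0 ((2 * n%:R)^-1 * dotv h h)) => t /andP[t0 t1].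
have := xmin (x + t *: (z - x)); rewrite !norm2_sqr.
rewrite (_ : y - X *m (x + t *: (z - x)) = r - t *: h); last first.
  by rewrite mulmxDr -scalemxAr opprD addrA.
rewrite dotv_subZ.
(* Convexity of the l1 norm, the argument being a convex combination of [z - c] and [x - c]. *)
have : norm1 (x + t *: (z - x) - c) <= t * norm1 (z - c) + (1 - t) * norm1 (x - c).
  rewrite (_ : _ - c = t *: (z - c) + (1 - t) *: (x - c)).
    by rewrite (le_trans (norm1D _ _))// !norm1Z !ger0_norm ?subr_ge0// ltW.
  by apply/matrixP => i j; rewrite !mxE; ring.
move=> /(ler_wpM2l l0).
rewrite invfM.
set k := n%:R^-1.
move: (norm1 _) (norm1 _) (norm1 _) (dotv r h) (dotv r r) (dotv h h) => A B C D E F.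
lra.
Qed.

Lemma norm1_subvec m (J : {set 'I_m}) (v : 'cV[R]_m) :
  norm1 (subvec J v) = \sum_(j in J) `|v j 0|.
Proof. by rewrite big_enum_val; apply: eq_bigr => k _; rewrite mxE. Qed.

(** Cauchy-Schwarz against the constant vector: the sum of the squares of [m%:R * |v i 0| - norm1 v]
    is [m%:R] times the difference of the two sides. Cancelling that factor requires [m > 0], whence
    the separate empty case. *)
Lemma norm1_sqr_le m (v : 'cV[R]_m) : norm1 v ^+ 2 <= m%:R * norm2 v ^+ 2.
Proof.
case: m v => [v|m v]; first by rewrite /norm1 big_ord0 expr0n mul0r.
move: m.+1 (ltn0Sn m) v => {}m m0 v.
have mR : 0 < m%:R :> R by rewrite ltr0n.
have : 0 <= \sum_(i < m) (m%:R * `|v i 0| - norm1 v) ^+ 2.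
  by apply: sumr_ge0 => i _; rewrite sqr_ge0.
rewrite (eq_bigr (fun i : 'I_m => m%:R ^+ 2 * v i 0 ^+ 2
    + (- 2 * m%:R * norm1 v) * `|v i 0| + norm1 v ^+ 2)); last first.
  by move=> i _; rewrite -(real_normK (num_real (v i 0))); ring.
rewrite !big_split /= -!mulr_sumr -/(norm1 v) sumr_const card_ord -(mulr_natl (norm1 v)).
rewrite (_ : \sum_(i < m) v i 0 ^+ 2 = norm2 v ^+ 2); last first.
  by rewrite norm2_sqr; apply: eq_bigr => i _; rewrite expr2.
rewrite (_ : _ + _ = m%:R * (m%:R * norm2 v ^+ 2 - norm1 v ^+ 2)); last by ring.
by rewrite pmulr_rge0// subr_ge0.
Qed.

(** With a = X(bstar - bbar) and b = X(bstar - bhat), polarization turns the cross term <a, a - b>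
    of the optimality condition into |a|^2 - |b|^2 plus the nonnegative |a - b|^2, which is dropped.
    The noise costs lambda1 |bbar - bhat|_1, hence the coefficient 2 lambda2 - lambda1. *)
Lemma boosted_lasso_error n p (X : 'M[R]_(n, p)) (e : 'cV[R]_n)
    (bstar bhat bbar : 'cV[R]_p) (lambda1 lambda2 : R) : (0 < n)%N ->
  0 <= lambda2 ->
  (forall j, `|dotv (col j X) e| <= n%:R * (lambda1 / 2)) ->
  boosted_lasso X (X *m bstar + e) lambda2 bhat bbar ->
  n%:R^-1 * norm2 (X *m (bstar - bbar)) ^+ 2
    + (2 * lambda2 - lambda1) * norm1 (bbar - bhat)
  <= n%:R^-1 * norm2 (X *m (bstar - bhat)) ^+ 2.
Proof.
move=> n0 l2 noise /(@penalized_argmin_optimality _ _ _ _ _ _ _ bhat l2).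
have nR : 0 < n%:R :> R by rewrite ltr0n.
rewrite subrr norm10 sub0r.
set a := X *m (bstar - bbar); set b := X *m (bstar - bhat).
have -> : X *m bstar + e - X *m bbar = a + e by rewrite /a mulmxBr addrAC.
have := dotv_mulmx_le (bhat - bbar) noise.
have -> : X *m (bhat - bbar) = a - b.
  by rewrite /a /b -mulmxBr; congr (X *m _); apply/matrixP => i j; rewrite !mxE; ring.
rewrite -[bhat - bbar]opprB norm1N !norm2_sqr.
have -> : dotv b b = dotv a a - 2 * dotv a (a - b) + dotv (a - b) (a - b).
  by rewrite !(dotvDl, dotvDr, dotvNl, dotvNr) (dotvC b a); ring.
rewrite dotvDl.
have := dotv_ge0 (a - b).
move: (dotv _ _) (dotv _ _) (dotv _ _) (dotv _ _) (norm1 _) => A B C D N A0.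
rewrite ler_norml => /andP[h _].
have : n%:R^-1 * - (n%:R * (lambda1 / 2) * N) <= n%:R^-1 * C.
  by rewrite ler_pM2l ?invr_gt0.
rewrite (_ : _ * - _ = - (lambda1 / 2 * N)); last by field; rewrite gt_eqF.
have := mulr_ge0 (ltW (_ : 0 < n%:R^-1)) A0; rewrite invr_gt0 => /(_ nR).
set k := n%:R^-1; lra.
Qed.

(** The first-order condition bounds the full prediction error [Q], where comparing objective values
    would bound only Q / 2; this is the source of the constant 9/4 instead of 9. *)
Lemma lasso_error n p s (X : 'M[R]_(n, p)) (e : 'cV[R]_n)
    (bstar bhat : 'cV[R]_p) (lambda kappa : R) : (0 < n)%N ->
  0 < lambda -> #|vsupport bstar| = s -> restricted_eigenvalue X 3 s kappa ->
  (forall j, `|dotv (col j X) e| <= n%:R * (lambda / 2)) ->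
  lasso X (X *m bstar + e) lambda bhat ->
  n%:R^-1 * norm2 (X *m (bstar - bhat)) ^+ 2 <=
    9 * lambda ^+ 2 * s%:R / (4 * kappa ^+ 2).
Proof.
move=> n0 l0 cardS [_ _ k0 RE] noise xmin.
have nR : 0 < n%:R :> R by rewrite ltr0n.
set S := vsupport bstar in cardS; set D := bstar - bhat.
(* The Lasso is the penalized problem centred at [c = 0], tested here against [bstar]. *)
have := @penalized_argmin_optimality _ _ X (X *m bstar + e) lambda 0 bhat bstar (ltW l0).
under [X in argmin X]eq_fun do rewrite subr0.
move=> /(_ xmin); rewrite !subr0 -/D.
have -> : X *m bstar + e - X *m bhat = X *m D + e by rewrite mulmxBr addrAC.
rewrite dotvDl -norm2_sqr.
have := dotv_mulmx_le D noise; rewrite ler_norml => /andP[noiseD _].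
have {}noiseD : - (lambda / 2 * norm1 D) <= n%:R^-1 * dotv e (X *m D).
  rewrite (_ : - _ = n%:R^-1 * - (n%:R * (lambda / 2) * norm1 D)).
    by rewrite ler_pM2l ?invr_gt0.
  by field; rewrite gt_eqF.
rewrite mulrDr; set Q := n%:R^-1 * _.
have Q0 : 0 <= Q by rewrite mulr_ge0 ?sqr_ge0// invr_ge0 ltW.
have split1 (v : 'cV[R]_p) :
    norm1 v = norm1 (subvec S v) + norm1 (subvec (~: S)%SET v).
  rewrite !norm1_subvec /norm1 (bigID (mem S)) /=; congr (_ + _).
  by apply: eq_bigl => j; rewrite finset.in_setC.
have inSC j : (j \in ~: S)%SET = (bstar j 0 == 0).
  by rewrite finset.in_setC finset.inE negbK.
have bsc : norm1 (subvec (~: S)%SET bstar) = 0.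
  rewrite norm1_subvec big1// => j; rewrite inSC => /eqP ->.
  by rewrite normr0.
(* Off the support [bstar] vanishes, so [bhat] and [D] agree there up to sign. *)
have hsc : norm1 (subvec (~: S)%SET bhat) = norm1 (subvec (~: S)%SET D).
  rewrite !norm1_subvec; apply: eq_bigr => j; rewrite inSC => /eqP bj.
  by rewrite !mxE bj sub0r normrN.
have bs : norm1 (subvec S bstar) <= norm1 (subvec S D) + norm1 (subvec S bhat).
  rewrite !norm1_subvec -big_split; apply: ler_sum => j _ /=.
  by rewrite !mxE -{1}[bstar j 0](subrK (bhat j 0)) ler_normD.
have DS0 := norm1_ge0 (subvec S D).
have DSc0 := norm1_ge0 (subvec (~: S)%SET D).
rewrite (split1 bstar) (split1 bhat) bsc hsc addr0 => opt.
rewrite (split1 D) in noiseD.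
(* The noise uses up lambda / 2 on both blocks: lambda / 2 survives off the support and 3 lambda / 2
   appears on it, which yields the cone condition with constant 3. *)
have QD : Q + lambda / 2 * norm1 (subvec (~: S)%SET D) <=
    3 / 2 * lambda * norm1 (subvec S D).
  have : lambda * (norm1 (subvec S bstar) - (norm1 (subvec S bhat)
      + norm1 (subvec (~: S)%SET D))) <=
    lambda * (norm1 (subvec S D) - norm1 (subvec (~: S)%SET D)).
    by rewrite ler_pM2l//; lra.
  lra.
have rhs0 : 0 <= 9 * lambda ^+ 2 * s%:R / (4 * kappa ^+ 2).
  by rewrite divr_ge0// mulr_ge0// ?mulr_ge0// ltW// exprn_gt0.
(* If [D] vanishes on [S], the restricted eigenvalue condition says nothing, but [QD] already forces
   [Q <= 0]. *)
have [D0|DN0] := eqVneq (subvec S D) 0.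
  apply: le_trans rhs0; rewrite D0 norm10 in QD; nra.
have cone : norm1 (subvec (~: S)%SET D) <= 3 * norm1 (subvec S D) by nra.
have Ss : (#|S| <= s)%N by rewrite cardS.
have := RE S D Ss DN0 cone.
have := norm1_sqr_le (subvec S D).
set N := norm1 (subvec S D) in QD DS0 *; set M := norm2 (subvec S D) ^+ 2.
have K0 : 0 < kappa ^+ 2 by rewrite exprn_gt0.
have M0 : 0 <= M by exact: sqr_ge0.
rewrite (_ : _ / (n%:R * M) = Q / M); last by rewrite /Q invfM mulrCA mulrA.
rewrite cardS => CS KM.
(* If [M] were 0, the quotient [Q / M] would be 0 by the convention on inverses, against
   [0 < kappa ^+ 2]. *)
have {}M0 : 0 < M.
  rewrite lt_neqAle M0 andbT eq_sym; apply/eqP => M0'.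
  by move: KM; rewrite M0' invr0 mulr0 leNgt K0.
rewrite ler_pdivlMr// in KM.
rewrite ler_pdivlMr ?mulr_gt0//.
have [->|Qn0] := eqVneq Q 0.
  by rewrite mul0r mulr_ge0// mulr_ge0// ltW// exprn_gt0.
have {Qn0}Q1 : 0 < Q by rewrite lt_neqAle eq_sym Qn0.
have QN : Q <= 3 / 2 * lambda * N by nra.
have QQ : Q ^+ 2 <= (3 / 2 * lambda) ^+ 2 * (s%:R * M).
  apply: (@le_trans _ _ ((3 / 2 * lambda * N) ^+ 2)).
    by rewrite ler_sqr ?nnegrE// (le_trans Q0).
  by rewrite exprMn ler_pM2l// exprn_gt0//; lra.
(* Multiplying the goal by [Q] lets Q^2 <= (9/4) lambda^2 s M combine with kappa^2 M <= Q. *)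
rewrite -(ler_pM2l Q1).
have := ler_wpM2l (ltW K0) QQ.
have : 9 * lambda ^+ 2 * s%:R * (kappa ^+ 2 * M) <= 9 * lambda ^+ 2 * s%:R * Q.
  by rewrite ler_wpM2l// mulr_ge0// mulr_ge0// ltW// exprn_gt0.
lra.
Qed.

End deterministic.

(** * Translation invariance and normal densities *)

Section translation.
Context {R : realType}.
Local Open Scope ereal_scope.
Local Notation mu := (@lebesgue_measure R).

(** By uniqueness of Lebesgue measure it suffices to compare the lengths of half-open intervals. *)
Lemma lebesgue_measure_shift (c : R) (A : set R) : measurable A ->
  pushforward mu ((fun x => x + c)%R : _ -> measurableTypeR R) A = mu A.
Proof.
move=> mA.
have mf : measurable_fun setT
    ((fun x => x + c)%R : measurableTypeR R -> measurableTypeR R).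
  exact: measurable_funD.
apply/esym/lebesgue_measure_unique => //= _ [[a b]] _ <-.
rewrite /pushforward /=.
rewrite [X in _ = mu X](_ : _ = `]a - c, b - c]%classic)%R; last first.
  by apply/seteqP; split => x/=; rewrite !in_itv/= ltrBlDr lerBrDr.
rewrite !lebesgue_measure_itv/= !lte_fin ltrD2r.
by case: ifP => // _; rewrite -!EFinB; congr EFin; ring.
Qed.

Lemma ge0_integral_shift (c : R) (f : R -> \bar R) :
  measurable_fun setT f -> (forall x, 0 <= f x) ->
  \int[mu]_x f (x + c)%R = \int[mu]_x f x.
Proof.
move=> mf f0.
transitivity (\int[pushforward mu ((fun x => x + c)%R : _ -> measurableTypeR R)]_x f x).
  by rewrite ge0_integral_pushforward//; exact: measurable_funD.
apply: eq_measure_integral => [|mc A mA _]; first exact: measurable_funD.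
exact: lebesgue_measure_shift.
Qed.
End translation.

Section normal.
Context {R : realType}.
Local Open Scope ereal_scope.
Local Notation mu := (@lebesgue_measure R).

(** The Radon-Nikodym derivative and [normal_pdf] have the same integral over every measurable set,
    so they agree almost everywhere. *)
Lemma ge0_integral_normal_prob (m sigma : R) (f : R -> \bar R) :
  measurable_fun setT f -> (forall x, 0 <= f x) ->
  \int[normal_prob m sigma]_x f x =
  \int[mu]_x (f x * (normal_pdf m sigma x)%:E).
Proof.
move=> mf f0.
have dom := normal_prob_dominates m sigma.
rewrite -(Radon_Nikodym_SigmaFinite.change_of_variables dom)//.
have fi := Radon_Nikodym_SigmaFinite.f_integrable dom.
have mpdf : measurable_fun setT (EFin \o normal_pdf m sigma).
  by apply/measurable_EFinP; exact: measurable_normal_pdf.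
apply: ae_eq_integral => //.
- by apply: emeasurable_funM => //; exact: measurable_int fi.
- exact: emeasurable_funM.
- apply: ae_eqe_mul2l; apply: integral_ae_eq => //.
  by move=> E _ mE; rewrite -Radon_Nikodym_SigmaFinite.f_integral.
Qed.
End normal.

(** * Independence and product laws *)

(** Rectangles form a generating class stable under intersection; as [m1] is finite, the constant
    sequence [setT] serves as exhaustion. *)
Lemma measure_prod_unique d1 d2 (T1 : measurableType d1) (T2 : measurableType d2)
    (R : realType) (m1 m2 : {measure set (T1 * T2) -> \bar R}) :
  (m1 setT < +oo)%E ->
  (forall A B, measurable A -> measurable B -> m1 (A `*` B) = m2 (A `*` B)) ->
  forall D, measurable D -> m1 D = m2 D.
Proof.
move=> m1oo m12.
pose C : set (set (T1 * T2)) :=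
  [set A `*` B | A in measurable & B in measurable].
apply: (measure_unique C (fun=> setT)) => //.
- exact: measurable_prod_measurableType.
- move=> _ _ [A1 mA1 [B1 mB1 <-]] [A2 mA2 [B2 mB2 <-]].
  rewrite -setXI; exists (A1 `&` A2); first exact: measurableI.
  by exists (B1 `&` B2) => //; exact: measurableI.
- by move=> _; exists setT => //; exists setT => //; rewrite setXTT.
- by rewrite bigcup_const.
- by move=> _ [A mA [B mB <-]]; exact: m12.
Qed.

(** Stated for bare functions, so that sums and multiples of random variables qualify without being
    packaged. *)
Definition independent2 (R : realType) (d : measure_display)
    (T : measurableType d) (P : probability T R) (X Y : T -> R) :=
  forall A B, measurable A -> measurable B ->
    P (X @^-1` A `&` Y @^-1` B) = (P (X @^-1` A) * P (Y @^-1` B))%E.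

Section integral_independent.
Context {R : realType} d (T : measurableType d) (P : probability T R).
Local Open Scope ereal_scope.
Context (X Y : T -> R).
Context (mX : measurable_fun setT X) (mY : measurable_fun setT Y).

(** The joint law agrees with the product of the marginals on rectangles, hence everywhere, and
    Tonelli's theorem splits the integral. *)
Lemma ge0_integral_independent2 (h : R -> R -> \bar R) :
  independent2 P X Y ->
  measurable_fun setT (fun z => h z.1 z.2) -> (forall x y, 0 <= h x y) ->
  \int[P]_w h (X w) (Y w) = \int[P]_w \int[P]_w' h (X w) (Y w').
Proof.
move=> XY mh h0.
pose X' : {mfun T >-> R} := HB.pack X (isMeasurableFun.Build _ _ _ _ _ mX).
pose Y' : {mfun T >-> R} := HB.pack Y (isMeasurableFun.Build _ _ _ _ _ mY).
have mXY : measurable_fun setT (fun w => (X w, Y w)) by exact: measurable_fun_pair.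
transitivity (\int[pushforward P (fun w => (X w, Y w))]_z h z.1 z.2).
  by rewrite ge0_integral_pushforward.
transitivity (\int[distribution P X' \x distribution P Y']_z h z.1 z.2).
  apply: eq_measure_integral => D mD _; apply: measure_prod_unique => //.
    by rewrite [ltLHS]probability_setT ltry.
  move=> A B mA mB; rewrite /= product_measure1E//.
  exact: XY.
rewrite (fubini_tonelli1 (fun z => h z.1 z.2))//.
rewrite /fubini_F /=.
rewrite ge0_integral_distribution//; last 2 first.
  exact: (measurable_fun_fubini_tonelli_F (fun z => h z.1 z.2)).
  by move=> x; exact: integral_ge0.
apply: eq_integral => w _ /=.
rewrite ge0_integral_distribution//.
rewrite (_ : h (X w) = (fun z => h z.1 z.2) \o pair (X w))//.
by apply: measurableT_comp.
Qed.

End integral_independent.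

(* The Cameron-Martin identity of N(0, v); [v = 0] is allowed and then says
   nothing else than [X = 0] almost surely. *)
Definition gaussian_shift (R : realType) (d : measure_display)
    (T : measurableType d) (P : probability T R) (X : T -> R) (v : R) :=
  forall (t : R) (f : R -> \bar R), measurable_fun setT f ->
    (forall x, 0 <= f x)%E ->
    (\int[P]_w f (X w - t * v)%R =
     \int[P]_w (f (X w) * (expR (- (t * X w) - t ^+ 2 * v / 2))%:E))%E.

(** * The Cameron-Martin identity and the Gaussian tail *)

Section gaussian_shift.
Context {R : realType} d (T : measurableType d) (P : probability T R).
Local Open Scope ereal_scope.

Lemma measurable_shift_weight (t v : R) :
  measurable_fun setT (fun x : R => (expR (- (t * x) - t ^+ 2 * v / 2))%:E).
Proof.
apply/measurable_EFinP; apply: measurableT_comp => //.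
by apply: measurable_funD => //; apply: measurableT_comp.
Qed.

Lemma gaussian_shift0 : gaussian_shift P (fun=> 0%R) 0.
Proof.
move=> t f mf f0; apply: eq_integral => w _.
by rewrite !(mulr0, mul0r, subr0, oppr0) expR0 mule1.
Qed.

(** Translating by t sigma^2 moves the shift from [f] to the density; completing the square, the
    ratio of the translated density to the original one is the exponential weight. *)
Lemma gaussian_shift_normal (X : {RV P >-> R}) (sigma : R) : sigma != 0%R ->
  (forall B, measurable B -> distribution P X B = normal_prob 0 sigma B) ->
  gaussian_shift P X (sigma ^+ 2).
Proof.
move=> s0 XN t f mf f0.
have int (g : R -> \bar R) : measurable_fun setT g -> (forall x, 0 <= g x) ->
    \int[P]_w g (X w) =
    \int[lebesgue_measure]_x (g x * (normal_pdf 0 sigma x)%:E).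
  move=> mg g0; rewrite -ge0_integral_normal_prob//.
  (* [normal_prob] lives on [measurableTypeR R], which has the measurable sets of
     [R] but a different display. *)
  transitivity (\int[pushforward P (X : T -> measurableTypeR R)]_x g x).
    by rewrite ge0_integral_pushforward//; exact: measurable_funP X.
  apply: eq_measure_integral => [|mX A mA _]; first exact: measurable_funP X.
  exact: XN.
have mpdf : measurable_fun setT (EFin \o normal_pdf 0 sigma).
  by apply/measurable_EFinP; exact: measurable_normal_pdf.
rewrite (int (fun x => f (x - t * sigma ^+ 2)%R))//; last first.
  by apply: measurableT_comp => //; exact: measurable_funB.
rewrite (int (fun x => f x *
  (expR (- (t * x) - t ^+ 2 * sigma ^+ 2 / 2))%:E))//; last 2 first.
- by apply: emeasurable_funM => //; exact: measurable_shift_weight.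
- by move=> x; rewrite mule_ge0// lee_fin expR_ge0.
rewrite -(ge0_integral_shift (t * sigma ^+ 2)); last 2 first.
- apply: emeasurable_funM => //.
  by apply: measurableT_comp => //; exact: measurable_funB.
- by move=> x; rewrite mule_ge0// lee_fin normal_pdf_ge0.
apply: eq_integral => x _; rewrite addrK -muleA -EFinM; congr (_ * _%:E).
rewrite !normal_pdfE// [RHS]mulrCA; congr *%R.
rewrite /normal_fun -expRD; congr expR.
by field.
Qed.

(** The identity of [X] is used at parameter [t * a], with [f] composed with multiplication by [a];
    [a = 0] gives variance 0. *)
Lemma gaussian_shiftZ (X : T -> R) (a v : R) :
  gaussian_shift P X v -> gaussian_shift P (fun w => a * X w)%R (a ^+ 2 * v).
Proof.
move=> Xv t f mf f0.
transitivity (\int[P]_w f (a * (X w - (t * a) * v))%R).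
  by apply: eq_integral => w _; congr f; ring.
rewrite (Xv _ (fun x => f (a * x)%R))//.
  by apply: eq_integral => w _; congr (_ * (expR _)%:E); ring.
by apply: measurableT_comp => //; exact: measurable_funM.
Qed.

(** Independence makes both sides iterated integrals. The identity is applied to [Y] with [X]
    frozen, then, after Tonelli, to [X] with [Y] frozen; the two weights multiply to that of
    [v + w]. *)
Lemma gaussian_shiftD (X Y : T -> R) (v w : R) :
  measurable_fun setT X -> measurable_fun setT Y -> independent2 P X Y ->
  gaussian_shift P X v -> gaussian_shift P Y w ->
  gaussian_shift P (fun u => X u + Y u)%R (v + w).
Proof.
move=> mX mY XY Xv Yw t f mf f0.
pose e v := fun x : R => (expR (- (t * x) - t ^+ 2 * v / 2))%:E : \bar R.
have me u : measurable_fun setT (e u) by exact: measurable_shift_weight.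
have e0 u x : 0 <= e u x by rewrite lee_fin expR_ge0.
pose h x y := f (x - t * v + (y - t * w))%R.
pose k x y := f (x + y)%R * e w y * e v x.
have mk1 : measurable_fun setT (fun z : R * R => f (z.1 - t * v + z.2)%R * e w z.2).
  apply: emeasurable_funM; last exact: measurableT_comp.
  apply: (measurableT_comp mf); apply: measurable_funD => //.
  exact: measurable_funB.
have mh : measurable_fun setT (fun z => h z.1 z.2).
  apply: (measurableT_comp mf); apply: measurable_funD => //;
  exact: measurable_funB.
have mk : measurable_fun setT (fun z => k z.1 z.2).
  apply: emeasurable_funM; last exact: measurableT_comp.
  apply: emeasurable_funM; last exact: measurableT_comp.
  by apply: (measurableT_comp mf); exact: measurable_funD.
have swap (g : R -> R -> \bar R) : measurable_fun setT (fun z => g z.1 z.2) ->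
    (forall x y, 0 <= g x y) ->
    \int[P]_u \int[P]_u' g (X u) (Y u') = \int[P]_u' \int[P]_u g (X u) (Y u').
  move=> mg g0; rewrite (fubini_tonelli (fun z => g (X z.1) (Y z.2)))//.
  apply: (@measurableT_comp _ _ _ _ _ _ _ _ (fun z => (X z.1, Y z.2)) mg).
  by apply: measurable_fun_pair; exact: measurableT_comp.
transitivity (\int[P]_u h (X u) (Y u)).
  by apply: eq_integral => u _; congr f; ring.
rewrite ge0_integral_independent2//; last by move=> x y; exact: f0.
transitivity (\int[P]_u \int[P]_u' (f (X u - t * v + Y u')%R * e w (Y u'))).
  apply: eq_integral => u _; apply: (Yw _ (fun y => f (X u - t * v + y)%R)) => //.
  by apply: measurableT_comp => //; exact: measurable_funD.
rewrite (swap (fun x y => f (x - t * v + y)%R * e w y))//; last first.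
  by move=> x y; rewrite mule_ge0.
transitivity (\int[P]_u' \int[P]_u k (X u) (Y u')).
  apply: eq_integral => u' _.
  apply: (Xv _ (fun x => f (x + Y u')%R * e w (Y u'))); last first.
    by move=> x; rewrite mule_ge0.
  apply: emeasurable_funM => //.
  by apply: measurableT_comp => //; exact: measurable_funD.
have k0 x y : 0 <= k x y by rewrite !mule_ge0.
rewrite -swap// -ge0_integral_independent2//.
apply: eq_integral => u _; rewrite /k -muleA -EFinM -expRD.
by congr (_ * (expR _)%:E); field.
Qed.

Lemma gaussian_shift_tail (X : T -> R) (t v : R) : measurable_fun setT X ->
  (0 <= t)%R -> gaussian_shift P X v ->
  P [set w | (t * v < `|X w|)%R] <= (expR (- (t ^+ 2 * v / 2)))%:E.
Proof.
move=> mX t0 Xv; set c := expR _.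
have mpos : measurable [set x : R | (0 < x)%R].
  by rewrite -set_itvoy.
have mneg : measurable [set x : R | (x < 0)%R].
  by rewrite -set_itvNyo.
have mXp E : measurable E -> measurable (X @^-1` E).
  by move=> mE; rewrite -[X in measurable X]setTI; exact: mX.
have mXs (r : R) (D : set R) : measurable D ->
    measurable (X @^-1` [set x | D (x - r * v)%R]).
  move=> mD; have mXc : measurable_fun setT (fun w => X w - r * v)%R.
    exact: measurable_funB.
  by rewrite -[X in measurable X]setTI; exact: mXc.
(* Used with [r = t] on the positive half-line and [r = - t] on the negative one: since [r * x >= 0]
   on [D], the weight there is at most [c]. *)
have half (r : R) (D : set R) : (r ^+ 2 = t ^+ 2)%R -> measurable D ->
    (forall x, D x -> 0 <= r * x)%R ->
    P (X @^-1` [set x | D (x - r * v)%R]) <= c%:E * P (X @^-1` D).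
  move=> rt mD Dr.
  have mI : measurable_fun setT (fun x => (\1_D x)%:E : \bar R).
    exact/measurable_EFinP/measurable_indic.
  rewrite -[X in P X]setIT -integral_indic//; last exact: mXs.
  rewrite [leLHS](_ : _ = \int[P]_w (\1_D (X w - r * v)%R)%:E)//.
  rewrite (Xv _ (EFin \o \1_D))//; last by move=> x; rewrite lee_fin.
  rewrite -[X in _ * P X]setIT -integral_indic//; last exact: mXp.
  have mXD : measurable_fun setT (fun w => (\1_(X @^-1` D) w)%:E : \bar R).
    by apply/measurable_EFinP/measurable_indic; exact: mXp.
  rewrite -ge0_integralZl//; last by rewrite lee_fin expR_ge0.
  apply: ge0_le_integral => //.
  - by move=> w _; rewrite mule_ge0// lee_fin// expR_ge0.
  - apply: emeasurable_funM; first exact: measurableT_comp.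
    exact: (measurableT_comp (measurable_shift_weight _ _)).
  - by apply: emeasurable_funM.
  move=> w _; rewrite muleC /= -!EFinM lee_fin !indicE.
  rewrite (_ : (w \in X @^-1` D) = (X w \in D)); last by apply/idP/idP; rewrite !inE.
  case: (boolP (X w \in D)); rewrite ?mulr0// !mulr1 inE => XD.
  by rewrite ler_expR rt lerBlDr addrC subrr oppr_le0 Dr.
rewrite (_ : [set w | _] =
    (X @^-1` [set x | 0 < x - t * v]%R) `|` (X @^-1` [set x | x - (- t) * v < 0]%R)); last first.
  apply/seteqP; split => w /=; rewrite subr_gt0 mulNr opprK ltr_normr.
    by move=> /orP[|h]; [left|right; lra].
  by move=> [->//|h]; apply/orP; right; lra.
apply: le_trans (measureU2 _ (mXs _ _ mpos) (mXs _ _ mneg)) _.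
apply: le_trans (leeD (half t _ _ mpos _) (half (- t)%R _ _ mneg _)) _ => //.
- by move=> x /ltW x0; rewrite mulr_ge0.
- by rewrite sqrrN.
- by move=> x /ltW x0; rewrite mulNr -mulrN mulr_ge0// oppr_ge0.
(* The events X > 0 and X < 0 are disjoint, so their probabilities sum to at most 1 and no factor 2
   appears. *)
rewrite -ge0_muleDr// -measureU//; [|exact: mXp..|]; last first.
  by apply/seteqP; split => // w [/= /lt_trans h /h]; rewrite ltxx.
rewrite -[leRHS]mule1 lee_wpmul2l//; first by rewrite lee_fin expR_ge0.
by apply: probability_le1; apply: measurableU; exact: mXp.
Qed.
End gaussian_shift.

(** * Linear combinations of independent Gaussians *)

Section linear_combination.
Context {R : realType} d (T : measurableType d) (P : probability T R).
Context (n : nat) (Z : 'I_n -> {RV P >-> R}) (a : 'I_n -> R).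

Let S (s : seq 'I_n) (w : T) := \sum_(i <- s) a i * Z i w.

Let mS s : measurable_fun setT (S s).
Proof. by apply: measurable_sum => i; exact: measurable_funM. Qed.

Let mpre (X : T -> R) (A : set R) : measurable_fun setT X -> measurable A ->
  measurable (X @^-1` A).
Proof. by move=> mX mA; rewrite -[X in measurable X]setTI; exact: mX. Qed.

Let S_cons i s : S (i :: s) = (fun w => a i * Z i w + S s w).
Proof. by apply/funext => w; rewrite /S big_cons. Qed.

Context (indepZ : mutually_independent Z).

(** Absorbs an event of [Z i] into the family indexed by [J], so that an induction hypothesis
    applies to [i |: J]. *)
Let preimage_bigcap_setU1 i (J : {set 'I_n}) (A : set R) (B : 'I_n -> set R) :
  i \notin J ->
  Z i @^-1` A `&` \bigcap_(j in [set` J]) (Z j @^-1` B j) =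
  \bigcap_(j in [set` (i |: J)%SET]) (Z j @^-1` (if j == i then A else B j)).
Proof.
move=> iJ; apply/seteqP; split=> [w [Aw Bw] j /=|w h].
  rewrite in_setU1; case: eqVneq => [->//|_ /= jJ]; exact: Bw.
split; first by have := h i; rewrite /= eqxx; apply; rewrite setU11.
move=> j /= jJ; have := h j; rewrite /= in_setU1 jJ orbT => /(_ isT).
by case: eqVneq => [ji|//]; rewrite -ji jJ in iJ.
Qed.

Let mbigcap (J : {set 'I_n}) (B : 'I_n -> set R) :
  (forall i, measurable (B i)) ->
  measurable (\bigcap_(i in [set` J]) (Z i @^-1` B i)).
Proof. by move=> mB; apply: fin_bigcap_measurable => // i _; exact: mpre. Qed.

(* The events indexed by [J] are carried along so that the joint law of [Z i] and
   [S s] can be compared on rectangles in the induction on the summands. *)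
Lemma sum_independent (s : seq 'I_n) (J : {set 'I_n}) (B : 'I_n -> set R) A :
  uniq s -> (forall i, i \in s -> i \notin J) ->
  (forall i, measurable (B i)) -> measurable A ->
  P (S s @^-1` A `&` \bigcap_(i in [set` J]) (Z i @^-1` B i)) =
  (P (S s @^-1` A) * P (\bigcap_(i in [set` J]) (Z i @^-1` B i)))%E.
Proof.
elim: s J B A => [|i s IH] J B A.
  move=> _ _ mB mA.
  rewrite (_ : S [::] = cst 0); last by apply/funext => w; rewrite /S big_nil.
  rewrite preimage_cst; case: ifP => _.
    by rewrite setTI probability_setT mul1e.
  by rewrite set0I measure0 mul0e.
move=> /= /andP[is' us] sJ mB mA.
have iJ : i \notin J by apply: sJ; rewrite mem_head.
have sJ' j : j \in s -> j \notin J by move=> js; apply: sJ; rewrite inE js orbT.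
set C := \bigcap_(j in _) _.
have mC : measurable C by exact: mbigcap.
pose f w := (Z i w, S s w).
have mf : measurable_fun setT f by exact: measurable_fun_pair.
pose F : {mfun T >-> (R * R)%type} := HB.pack f (isMeasurableFun.Build _ _ _ _ _ mf).
have PC0 : 0 <= fine (P C) by exact: fine_ge0.
(* On [C] the joint law of [Z i] and [S s] is [P C] times the unrestricted one: both are measures on
   the plane, and it suffices to compare them on rectangles. *)
have key D : measurable D -> P (f @^-1` D `&` C) = (P C * P (f @^-1` D))%E.
  move=> mD; transitivity (mscale (NngNum PC0) (distribution P F) D); last first.
    by rewrite /mscale /= fineK// fin_num_measure.
  rewrite -[LHS]/(pushforward (mrestr P mC) F D).
  apply: measure_prod_unique => //.
    apply: le_lt_trans (probability_le1 P _) (ltry 1).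
    by rewrite preimage_setT setTI.
  move=> A1 B1 mA1 mB1.
  rewrite -[LHS]/(P (f @^-1` (A1 `*` B1) `&` C)).
  rewrite -[RHS]/((fine (P C))%:E * P (f @^-1` (A1 `*` B1)))%E.
  rewrite fineK ?fin_num_measure//.
  rewrite (_ : f @^-1` (A1 `*` B1) = S s @^-1` B1 `&` Z i @^-1` A1); last first.
    by apply/seteqP; split => w /= [? ?].
  (* The induction hypothesis for [i |: J] splits off [S s]; mutual independence then separates
     [Z i] from [C]. *)
  rewrite -setIA preimage_bigcap_setU1// IH//; last 2 first.
  - move=> j js; rewrite in_setU1 negb_or sJ'// andbT.
    by apply: contra is' => /eqP <-.
  - by move=> j; case: ifP.
  rewrite -preimage_bigcap_setU1// [X in (_ * X)%E](_ : _ = P (Z i @^-1` A1) * P C)%E; last first.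
    rewrite preimage_bigcap_setU1// (indepZ (B := fun j => if j == i then A1 else B j)); last first.
      by move=> j _; case: ifP.
    rewrite big_setU1//= eqxx; congr (_ * _)%E.
    rewrite indepZ//; apply: eq_bigr => j jJ.
    by case: eqVneq => // ji; rewrite -ji jJ in iJ.
  rewrite muleCA muleA muleC; congr (_ * _)%E.
  (* A second use, with the single index [i], gives the independence of [S s] and [Z i]. *)
  have := IH [set i]%SET (fun=> A1) B1 us.
  rewrite (_ : \bigcap_(_ in _) _ = Z i @^-1` A1); last first.
    apply/seteqP; split=> [w /(_ i)|w h j]; first by rewrite /= inE eqxx; exact.
    by rewrite /= inE => /eqP ->.
  rewrite muleC => -> // j js; rewrite inE.
  by apply: contra is' => /eqP <-.
rewrite S_cons.
have mg : measurable_fun setT (fun z : R * R => a i * z.1 + z.2).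
  by apply: measurable_funD => //; exact: measurable_funM.
have := key ((fun z : R * R => a i * z.1 + z.2) @^-1` A).
rewrite muleC; apply.
by rewrite -[X in measurable X]setTI; exact: mg.
Qed.

Lemma gaussian_shift_linear_combination (sigma : R) : 0 < sigma ->
  (forall (i : 'I_n) (B : set R), measurable B ->
    distribution P (Z i) B = normal_prob 0 sigma B) ->
  gaussian_shift P (fun w => \sum_(i < n) a i * Z i w)
    ((\sum_(i < n) a i ^+ 2) * sigma ^+ 2).
Proof.
move=> sigma0 ZN.
suff H (s : seq 'I_n) : uniq s ->
    gaussian_shift P (S s) ((\sum_(i <- s) a i ^+ 2) * sigma ^+ 2).
  by apply: H; exact: index_enum_uniq.
elim: s => [_|i s IH /= /andP[is' us]].
  rewrite big_nil mul0r (_ : S [::] = fun=> 0); first exact: gaussian_shift0.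
  by apply/funext => w; rewrite /S big_nil.
rewrite S_cons big_cons mulrDl; apply: gaussian_shiftD => //.
- exact: measurable_funM.
- move=> A B mA mB.
  have mA' : measurable ((fun x => a i * x) @^-1` A).
    rewrite -[X in measurable X]setTI.
    have : measurable_fun setT (fun x : R => a i * x) by exact: measurable_funM.
    exact.
  (* The only event carried along is that of [a i * Z i], pulled back to an event of [Z i]. *)
  have := @sum_independent s [set i]%SET (fun=> (fun x => a i * x) @^-1` A) B us.
  rewrite (_ : \bigcap_(_ in _) _ = (fun w => a i * Z i w) @^-1` A); last first.
    apply/seteqP; split=> [w /(_ i)|w h j]; first by rewrite /= inE eqxx; exact.
    by rewrite /= inE => /eqP ->.
  rewrite setIC muleC; apply => // j js; rewrite inE.
  by apply: contra is' => /eqP <-.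
- by apply: gaussian_shiftZ; apply: gaussian_shift_normal; [rewrite gt_eqF|exact: ZN].
- exact: IH.
Qed.
End linear_combination.

(** * The noise event and the conclusion *)

Theorem corollary2 (R : realType) (d : measure_display) (T : measurableType d)
    (P : probability T R) (n p s : nat) (X : 'M[R]_(n, p))
    (betastar : 'cV[R]_p) (sigma delta kappa lambda1 lambda2 : R)
    (eps : 'I_n -> {RV P >-> R}) (y : T -> 'cV[R]_n)
    (betahat betabar : T -> 'cV[R]_p)
    (hn : (0 < n)%N)
    (hX : forall j : 'I_p, norm2 (col j X) ^+ 2 = n%:R)
    (hs : #|vsupport betastar| = s)
    (hsigma : 0 < sigma)
    (heps : isotropic_gaussian eps sigma)
    (hy : forall w, y w = X *m betastar + \col_(i < n) eps i w)
    (hRE : restricted_eigenvalue X 3 s kappa)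
    (hdelta : 0 < delta < 1)
    (hlambda1 : lambda1 = 2 * sigma * Num.sqrt (2 * ln (p%:R / delta) / n%:R))
    (hlambda2 : 0 < lambda2)
    (hbetahat : forall w, lasso X (y w) lambda1 (betahat w))
    (hbetabar : forall w, boosted_lasso X (y w) lambda2 (betahat w) (betabar w)) :
  with_probability_at_least P (1 - delta)
    [set w | n%:R^-1 * norm2 (X *m (betastar - betabar w)) ^+ 2
               + (2 * lambda2 - lambda1) * norm1 (betabar w - betahat w)
             <= 9 * lambda1 ^+ 2 * s%:R / (4 * kappa ^+ 2)].
Proof.
have nR : 0 < n%:R :> R by rewrite ltr0n.
have [_ /andP[s1 sp] _ _] := hRE.
have pR : 0 < p%:R :> R by rewrite ltr0n (leq_trans s1).
have p1 : 1 <= p%:R :> R by rewrite ler1n (leq_trans s1).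
have /andP[d0 d1] := hdelta.
set L := ln (p%:R / delta) in hlambda1.
have L0 : 0 < L.
  by rewrite ln_gt0// ltr_pdivlMr// mul1r (lt_le_trans d1).
have l10 : 0 < lambda1.
  by rewrite hlambda1 !mulr_gt0// sqrtr_gt0 divr_gt0// mulr_gt0.
(* The calibration of [lambda1]: it makes the tail exponent equal to [L], so that each column fails
   with probability at most delta / p. *)
have l1sq : (lambda1 / 2) ^+ 2 * n%:R = 2 * sigma ^+ 2 * L.
  rewrite hlambda1 [in LHS](_ : _ / 2 = sigma * Num.sqrt (2 * L / n%:R)); last by field.
  rewrite exprMn sqr_sqrtr; first by field; rewrite gt_eqF.
  by rewrite ltW// divr_gt0// mulr_gt0.
pose e w : 'cV[R]_n := \col_(i < n) eps i w.
pose N j w := \sum_(i < n) X i j * eps i w.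
have NE j w : N j w = dotv (col j X) (e w).
  by apply: eq_bigr => i _; rewrite !mxE.
have mN j : measurable_fun setT (N j).
  by apply: measurable_sum => i; exact: measurable_funM.
pose bad j := [set w | n%:R * (lambda1 / 2) < `|N j w|].
have mbad j : measurable (bad j).
  have mNj : measurable_fun setT (fun w => `|N j w|) by exact: measurableT_comp.
  have := mNj measurableT `]n%:R * (lambda1 / 2), +oo[%classic.
  by rewrite setTI set_itvoy; apply; rewrite -set_itvoy.
have Pbad j : (P (bad j) <= (delta / p%:R)%:E)%E.
  have := gaussian_shift_linear_combination (fun i => X i j) heps.2 hsigma heps.1.
  (* The column normalization gives each [N j] the variance n sigma^2. *)
  have -> : \sum_(i < n) X i j ^+ 2 = n%:R.
    rewrite -(hX j) norm2_sqr; apply: eq_bigr => i _.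
    by rewrite !mxE expr2.
  (* Chosen so that [t] times the variance n sigma^2 is the threshold n lambda1 / 2. *)
  pose t := lambda1 / 2 / sigma ^+ 2.
  have t0 : 0 <= t by rewrite ltW// !divr_gt0// exprn_gt0.
  move=> /(gaussian_shift_tail (mN j) t0).
  have s0 : sigma != 0 by rewrite gt_eqF.
  rewrite (_ : t * _ = n%:R * (lambda1 / 2)); last by rewrite /t; field.
  rewrite (_ : t ^+ 2 * (n%:R * sigma ^+ 2) / 2 = L); last first.
    rewrite /t exprMn [LHS](_ : _ = (lambda1 / 2) ^+ 2 * n%:R / (2 * sigma ^+ 2)); last by field.
    by rewrite l1sq; field.
  rewrite expRN lnK ?posrE ?divr_gt0//.
  by rewrite invf_div.
(* Union bound over the columns, proved together with the measurability of the union. *)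
have [mbads Pbads] : measurable (\big[setU/set0]_(j < p) bad j) /\
    (P (\big[setU/set0]_(j < p) bad j) <= \sum_(j < p) (delta / p%:R)%:E)%E.
  apply: (big_rec2 (fun A x => measurable A /\ (P A <= x)%E)).
    by rewrite measure0.
  move=> j A x _ [mA PA]; split; first exact: measurableU.
  exact: le_trans (measureU2 _ _ _) (leeD (Pbad j) PA).
exists (~` \big[setU/set0]_(j < p) bad j); split.
- exact: measurableC.
- move=> w /= hw.
  have noise j : `|dotv (col j X) (e w)| <= n%:R * (lambda1 / 2).
    rewrite -NE leNgt; apply/negP => hj; apply: hw.
    by rewrite (bigD1 j)//=; left.
  have hl := hbetahat w; have hb := hbetabar w; rewrite !hy in hl hb.
  apply: (le_trans (boosted_lasso_error hn (ltW hlambda2) noise hb)).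
  exact: (lasso_error hn l10 hs hRE noise hl).
- rewrite probability_setC// EFinB leeB// (le_trans Pbads)//.
  rewrite sumEFin sumr_const card_ord -(mulr_natl (delta / _)) mulrCA divff ?mulr1//.
  by rewrite gt_eqF.
Qed.
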